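(* Let $n\ge1$ and let $\mathcal{S}$ be a discrete subgroup of $O(n+1)$ satisfying the spanning property. Any maximizer over $\mathcal{K}_0(\mathcal{S})$ (with positive volume) of the functional $$\mathcal{F}_{-\infty}(\Omega)=V(\Omega)\Big/\big(\min_{\mathbb{S}^n}h_\Omega\big)^{n+1}$$ is an $\mathcal{S}$-invariant polytope.
   Context: $\mathcal{K}_0(\mathcal{S})$ is the set of convex bodies in $\mathbb{R}^{n+1}$ containing the origin and invariant under all $\phi\in\mathcal{S}$; $h_\Omega$ is the support function; $V(\Omega)=(n+1)|\Omega|$. Spanning property: for every $a\in\mathbb{S}^n$, $\mathrm{conv}\{\phi(a):\phi\in\mathcal{S}\}$ is a non-degenerate $(n+1)$-dimensional polytope. *)

(* Defs.v *)
From HB Require Import structures.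
From mathcomp Require Import all_boot all_order all_algebra.
From mathcomp Require Import all_classical all_reals all_analysis.
Set Implicit Arguments. Unset Strict Implicit. Unset Printing Implicit Defensive.
Import Order.TTheory GRing.Theory Num.Theory.
Import numFieldTopology.Exports numFieldNormedType.Exports.
Local Open Scope classical_set_scope.
Local Open Scope ring_scope.

Section Defs.
Variables (R : realType) (N : nat).
Notation vec := 'rV[R]_N.
Notation mat := 'M[R]_N.

Definition dotv (x y : vec) : R := \sum_(i < N) x 0 i * y 0 i.
Definition unit_sphere : set vec := [set u | dotv u u = 1].

(* orthogonal matrices; a matrix Q acts on row vectors by x |-> x *m Q *)
Definition orthogonal (Q : mat) : Prop := Q *m Q^T = 1%:M.

Definition subgroup_O (S : set mat) : Prop :=
  [/\ S 1%:M, (forall P Q, S P -> S Q -> S (P *m Q)),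
      (forall Q, S Q -> S (invmx Q)) & (forall Q, S Q -> orthogonal Q)].

Definition discrete_set (S : set mat) : Prop :=
  forall Q, S Q -> \forall P \near Q, S P -> P = Q.

Definition conv (A : set vec) : set vec :=
  [set x | exists (k : nat) (p : 'I_k -> vec) (w : 'I_k -> R),
     [/\ (forall i, A (p i)), (forall i, 0 <= w i), \sum_(i < k) w i = 1
       & x = \sum_(i < k) w i *: p i]].

Definition is_polytope (P : set vec) : Prop :=
  exists (k : nat) (p : 'I_k -> vec), P = conv (range p).

Definition spanning (S : set mat) : Prop :=
  forall a, unit_sphere a ->
    let P := conv [set a *m Q | Q in S] in is_polytope P /\ (interior P !=set0).

Definition convex_set (A : set vec) : Prop :=
  forall x y (t : R), A x -> A y -> 0 <= t <= 1 -> A (t *: x + (1 - t) *: y).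

Definition convex_body (A : set vec) : Prop :=
  [/\ compact A, convex_set A & A !=set0].

Definition S_invariant (S : set mat) (A : set vec) : Prop :=
  forall Q, S Q -> [set x *m Q | x in A] = A.

Definition K0 (S : set mat) (A : set vec) : Prop :=
  [/\ convex_body A, A 0 & S_invariant S A].

Definition support_fun (A : set vec) (u : vec) : R := sup [set dotv x u | x in A].
Definition min_support (A : set vec) : R :=
  inf [set support_fun A u | u in unit_sphere].

Definition box (a b : vec) : set vec :=
  [set x | forall i, a 0 i <= x 0 i <= b 0 i].
Definition box_vol (a b : vec) : R := \prod_(i < N) Num.max 0 (b 0 i - a 0 i).
Definition leb_vol (A : set vec) : \bar R :=
  ereal_inf [set e | exists a b : nat -> vec,
     A `<=` \bigcup_k box (a k) (b k) /\
     e = (\sum_(0 <= k <oo) (box_vol (a k) (b k))%:E)%E].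

(* F_{-infty}(A) = V(A) / (min_S^n h_A)^(n+1), V = N |A|, in the extended
   reals; if min h_A <= 0 the quotient V/0 is taken to be +oo. *)
Definition F_minf (A : set vec) : \bar R :=
  if 0 < min_support A then ((N%:R / (min_support A ^+ N))%:E * leb_vol A)%E
  else +oo%E.

End Defs.

(* Main.v *)
(** Let [r] be the minimum of the support function of [Om] on the sphere,
    attained at [u], and let [P] be the intersection of the half-spaces
    [<x, u Q> <= r], [Q] in [S]. Then [Om] is contained in [P], [P] is
    [S]-invariant, and both have the same minimal support [r], so maximality
    gives [|P| <= |Om|]. If some [x] in [P] were outside the closed set [Om], a
    small homothetic copy of [Om] near [x] would lie in [P] and in a cube
    disjoint from [Om], making [|P| > |Om|]; hence [Om = P]. Since the convex
    hull of the orbit of [u] is a polytope, finitely many half-spaces suffice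
    to define [P], and a bounded finite intersection of half-spaces is the
    convex hull of its vertices.

    Positivity of [r] and boundedness of [P] amount to the fact that no orbit
    of a nonzero vector lies in a closed half-space through the origin:
    otherwise there would be a nonempty [S]-invariant closed convex set avoiding
    the origin, whose point of least norm would be a nonzero vector fixed by
    [S], contradicting the spanning property. *)

Require Import Defs.
From HB Require Import structures.
From mathcomp Require Import all_boot all_order all_algebra.
From mathcomp Require Import all_classical all_reals all_analysis.
From mathcomp Require Import lra.
Import Order.TTheory GRing.Theory Num.Theory.
Import numFieldTopology.Exports numFieldNormedType.Exports.
Set Implicit Arguments. Unset Strict Implicit. Unset Printing Implicit Defensive.
Local Open Scope classical_set_scope.
Local Open Scope ring_scope.

(* MathComp-Analysis has homonyms of these two definitions. *)
Local Notation conv := Defs.conv.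
Local Notation convex_set := Defs.convex_set.

(** * Scalar product and its comparison with the coordinate norm *)

Section Dot.
Context {R : realType} {N : nat}.
Implicit Types (x y z u : 'rV[R]_N) (A : set 'rV[R]_N).

Lemma dotvC x y : dotv x y = dotv y x.
Proof. by apply: eq_bigr => i _; rewrite mulrC. Qed.

Lemma dotvDl x y z : dotv (x + y) z = dotv x z + dotv y z.
Proof. by rewrite -big_split; apply: eq_bigr => i _; rewrite mxE mulrDl. Qed.

Lemma dotvZl (c : R) x z : dotv (c *: x) z = c * dotv x z.
Proof. by rewrite mulr_sumr; apply: eq_bigr => i _; rewrite mxE mulrA. Qed.

Lemma dotv0l z : dotv 0 z = 0.
Proof. by apply: big1 => i _; rewrite mxE mul0r. Qed.

Lemma dotvNl x z : dotv (- x) z = - dotv x z.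
Proof. by rewrite -scaleN1r dotvZl mulN1r. Qed.

Lemma dotvBl x y z : dotv (x - y) z = dotv x z - dotv y z.
Proof. by rewrite dotvDl dotvNl. Qed.

Lemma dotvDr x y z : dotv x (y + z) = dotv x y + dotv x z.
Proof. by rewrite dotvC dotvDl !(dotvC x). Qed.

Lemma dotvZr (c : R) x z : dotv x (c *: z) = c * dotv x z.
Proof. by rewrite dotvC dotvZl dotvC. Qed.

Lemma dotvBr x y z : dotv x (y - z) = dotv x y - dotv x z.
Proof. by rewrite dotvC dotvBl !(dotvC x). Qed.

Lemma dotv_suml k (w : 'I_k -> R) (p : 'I_k -> 'rV[R]_N) z :
  dotv (\sum_i w i *: p i) z = \sum_i w i * dotv (p i) z.
Proof.
apply: (big_ind2 (fun x c => dotv x z = c)) => [|x ? y ? <- <-|i _]; first exact: dotv0l.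
  by rewrite dotvDl.
exact: dotvZl.
Qed.

Lemma dotvv_ge0 x : 0 <= dotv x x.
Proof. by apply: sumr_ge0 => i _; rewrite -expr2 sqr_ge0. Qed.

Lemma dotvv_eq0 x : dotv x x = 0 -> x = 0.
Proof.
move/eqP; rewrite psumr_eq0 => [/allP/= x0|i _]; last by rewrite -expr2 sqr_ge0.
apply/rowP => i; rewrite mxE; apply/eqP.
by have := x0 i; rewrite mem_index_enum mulf_eq0 orbb; exact.
Qed.

Lemma dotvv_gt0 x : x != 0 -> 0 < dotv x x.
Proof.
by move=> x0; rewrite lt_def dotvv_ge0 andbT; apply: contra_neq x0 => /dotvv_eq0.
Qed.

Lemma unit_sphere_normalize x : x != 0 ->
  unit_sphere ((Num.sqrt (dotv x x))^-1 *: x).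
Proof.
move=> x0; rewrite /unit_sphere/= dotvZl dotvZr mulrA -invfM -expr2.
by rewrite sqr_sqrtr ?dotvv_ge0// mulVf// gt_eqF// dotvv_gt0.
Qed.

Lemma dotv_mulmx (Q : 'M[R]_N) x y : dotv (x *m Q) y = dotv x (y *m Q^T).
Proof.
have dE u v : dotv u v = (u *m v^T) 0 0.
  by rewrite mxE; apply: eq_bigr => i _; rewrite mxE.
by rewrite !dE trmx_mul trmxK mulmxA.
Qed.

Lemma dotv_trmx (Q : 'M[R]_N) x y : dotv (x *m Q^T) y = dotv x (y *m Q).
Proof. by rewrite dotv_mulmx trmxK. Qed.

Lemma le_coord_norm x i : `|x 0 i| <= `|x|.
Proof.
rewrite [leRHS]/Num.Def.normr/= mx_normrE.
exact: (@le_bigmax _ _ _ 0 (fun ij : 'I_1 * 'I_N => `|x ij.1 ij.2|) (0, i)).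
Qed.

Lemma norm_le_coord x (e : R) : 0 <= e -> (forall i, `|x 0 i| <= e) -> `|x| <= e.
Proof.
move=> e0 xe; rewrite [leLHS]/Num.Def.normr/= mx_normrE.
by apply: bigmax_le => // -[i j] _; rewrite ord1.
Qed.

(** [|x|] is the maximum norm, hence the factor [N] in place of the Cauchy-Schwarz constant 1. *)
Lemma le_norm_dotv x y : `|dotv x y| <= N%:R * `|x| * `|y|.
Proof.
apply: le_trans (ler_norm_sum _ _ _) _.
have -> : N%:R * `|x| * `|y| = \sum_(i < N) `|x| * `|y|.
  by rewrite sumr_const card_ord -mulrA mulr_natl.
by apply: ler_sum => i _; rewrite normrM ler_pM// le_coord_norm.
Qed.

Lemma norm_sqr_le_dotv x : `|x| ^+ 2 <= dotv x x.
Proof.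
rewrite -[leRHS](sqr_sqrtr (dotvv_ge0 x)) ler_sqr ?nnegrE ?sqrtr_ge0//.
apply: norm_le_coord; first exact: sqrtr_ge0.
move=> i; rewrite -sqrtr_sqr ler_sqrt ?dotvv_ge0//.
rewrite /dotv (bigD1 i)//= -expr2 lerDl.
by apply: sumr_ge0 => j _; rewrite -expr2 sqr_ge0.
Qed.

Lemma continuous_dotv (f g : 'rV[R]_N -> 'rV[R]_N) :
  continuous f -> continuous g -> continuous (fun x => dotv (f x) (g x)).
Proof.
move=> cf cg; apply: continuous_big => [|i _ x]; first exact: add_continuous.
have coord (h : 'rV[R]_N -> 'rV[R]_N) : continuous h -> continuous (fun x => h x 0 i).
  move=> ch {}x; apply: (@continuous_comp _ _ _ h (fun M : 'rV[R]_N => M 0 i)).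
    exact: ch.
  exact: coord_continuous.
exact: (continuousM (coord f cf x) (coord g cg x)).
Qed.

Lemma continuous_dotvv : continuous (fun x : 'rV[R]_N => dotv x x).
Proof. by apply: (continuous_dotv (f := id) (g := id)) => x; exact: cvg_id. Qed.

Lemma closed_dotv_le u (c : R) : closed [set x : 'rV[R]_N | dotv x u <= c].
Proof.
apply: (@closed_comp _ _ (fun x => dotv x u) [set y | y <= c]); last exact: closed_le.
by move=> x _; apply: (continuous_dotv (f := id) (g := fun=> u)) => ?;
  [exact: cvg_id|exact: cst_continuous].
Qed.

Lemma closed_dotvv (c : R) : closed [set x : 'rV[R]_N | dotv x x <= c].
Proof.
apply: (@closed_comp _ _ (fun x => dotv x x) [set y | y <= c]); last exact: closed_le.
by move=> x _; exact: continuous_dotvv.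
Qed.

Lemma bounded_setP A (M : R) : (forall x, A x -> `|x| <= M) -> bounded_set A.
Proof.
move=> AM; exists M; split; first exact: num_real.
by move=> e Me x Ax; apply: le_trans (AM x Ax) (ltW Me).
Qed.

(** Follows from [a <= 1 + a ^+ 2]: a crude bound without square roots, enough to get
    boundedness. *)
Lemma norm_le_of_dotvv x (c : R) : dotv x x <= c -> `|x| <= 1 + c.
Proof.
move=> xc; have := norm_sqr_le_dotv x; have := normr_ge0 x.
by move: (`|x|) (dotv x x) xc => a b; rewrite expr2; nra.
Qed.

(** [A] may be unbounded; cutting it with the Euclidean ball through one of its points leaves a
    compact set with the same minimum. *)
Lemma exists_min_dotvv A : closed A -> A !=set0 ->
  exists2 c, A c & forall x, A x -> dotv c c <= dotv x x.
Proof.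
move=> cA [x0 Ax0]; pose B := A `&` [set x | dotv x x <= dotv x0 x0].
have cB : compact B.
  apply: bounded_closed_compact; last by apply: closedI => //; exact: closed_dotvv.
  by apply: (@bounded_setP _ (1 + dotv x0 x0)) => x [_ /norm_le_of_dotvv].
have B0 : B !=set0 by exists x0; split => //=.
have cf : {within B, continuous (fun x : 'rV[R]_N => dotv x x)}.
  exact/continuous_subspaceT/continuous_dotvv.
have [c /set_mem[Ac _] cmin] := EVT_min_rV B0 cB cf.
exists c => // x Ax; case: (leP (dotv x x) (dotv x0 x0)) => [xx0|/ltW x0x].
  by apply: cmin; rewrite inE.
by apply: le_trans x0x; apply: cmin; rewrite inE; split => //=.
Qed.

Lemma compact_unit_sphere : compact (@unit_sphere R N).
Proof.
apply: bounded_closed_compact.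
  by apply: (@bounded_setP _ (1 + 1)) => x /= x1; apply: norm_le_of_dotvv; rewrite x1.
apply: (@closed_comp _ _ (fun x => dotv x x) [set 1]); last exact: closed_eq.
by move=> x _; exact: continuous_dotvv.
Qed.

(** * Support functions of bounded sets *)

Section Support.
Variables (A : set 'rV[R]_N) (M : R).
Hypotheses (A0 : A !=set0) (AM : forall x, A x -> `|x| <= M).

Lemma has_sup_dotv u : has_sup [set dotv x u | x in A].
Proof.
split; first by case: A0 => x Ax; exists (dotv x u), x.
exists (N%:R * M * `|u|) => _ [x Ax <-].
rewrite (le_trans (ler_norm _))// (le_trans (le_norm_dotv _ _))//.
by rewrite ler_wpM2r// ler_wpM2l// AM.
Qed.

Lemma dotv_le_support_fun x u : A x -> dotv x u <= support_fun A u.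
Proof. by move=> Ax; apply: sup_upper_bound (has_sup_dotv u) _ _; exists x. Qed.

Lemma support_fun_le u (c : R) : (forall x, A x -> dotv x u <= c) ->
  support_fun A u <= c.
Proof.
move=> Ac; apply: ge_sup; first exact: (has_sup_dotv u).1.
by move=> _ [x Ax <-]; exact: Ac.
Qed.

Lemma support_fun_lipschitz u v :
  support_fun A u - support_fun A v <= N%:R * M * `|u - v|.
Proof.
rewrite lerBlDr; apply: support_fun_le => x Ax.
rewrite -[u in dotv x u](subrK v) dotvDr lerD//; last exact: dotv_le_support_fun.
rewrite (le_trans (ler_norm _))// (le_trans (le_norm_dotv _ _))//.
by rewrite ler_wpM2r// ler_wpM2l// AM.
Qed.

Lemma continuous_support_fun : continuous (support_fun A).
Proof.
move=> u B /nbhs_ballP[e /= e0 eB].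
have M0 : 0 <= M by case: A0 => x /AM; apply: le_trans.
have NM0 : 0 <= N%:R * M by rewrite mulr_ge0.
(* The added 1 keeps the divisor positive when [N%:R * M] vanishes. *)
have c0 : 0 < N%:R * M + 1 by rewrite ltr_wpDl.
apply/nbhs_ballP; exists (e / (N%:R * M + 1)) => /=; first by rewrite divr_gt0.
move=> v; rewrite mx_norm_ball/= ltr_pdivlMr// => uv; apply: eB.
have le_e : N%:R * M * `|u - v| < e.
  by apply: le_lt_trans uv; rewrite mulrC ler_wpM2l// lerDl.
rewrite -ball_normE/= ltr_norml ltrNl opprB.
by rewrite !(le_lt_trans (support_fun_lipschitz _ _))// distrC.
Qed.

Lemma exists_min_support : @unit_sphere R N !=set0 ->
  exists2 u0, unit_sphere u0 &
    forall u, unit_sphere u -> support_fun A u0 <= support_fun A u.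
Proof.
move=> s0.
have cf : {within @unit_sphere R N, continuous (support_fun A)}.
  exact/continuous_subspaceT/continuous_support_fun.
have [c /set_mem sc cmin] := EVT_min_rV s0 compact_unit_sphere cf.
by exists c => // u su; apply: cmin; rewrite inE.
Qed.

Lemma min_supportE (r : R) u0 : unit_sphere u0 -> support_fun A u0 = r ->
  (forall u, unit_sphere u -> r <= support_fun A u) -> min_support A = r.
Proof.
move=> su0 u0r rmin; apply/eqP; rewrite eq_le; apply/andP; split.
  rewrite -u0r; apply: ge_inf; last by exists u0.
  by exists r => _ [u su <-]; exact: rmin.
apply: lb_le_inf; first by exists (support_fun A u0), u0.
by move=> _ [u su <-]; exact: rmin.
Qed.

End Support.
End Dot.

(** * The outer measure [leb_vol]: subadditivity, cutting, scaling *)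

Section Volume.
Context {R : realType} {N : nat}.
Implicit Types (a b x : 'rV[R]_N) (A B D E H : set 'rV[R]_N).

Lemma box_vol_ge0 a b : 0 <= box_vol a b.
Proof. by apply: prodr_ge0 => i _; rewrite le_max lexx. Qed.

Lemma leb_vol_le A (a b : nat -> 'rV[R]_N) : A `<=` \bigcup_k box (a k) (b k) ->
  (leb_vol A <= \sum_(0 <= k <oo) (box_vol (a k) (b k))%:E)%E.
Proof. by move=> cov; apply: ereal_inf_lbound; exists a, b. Qed.

Lemma leb_vol_ge A (v : \bar R) :
  (forall a b : nat -> 'rV[R]_N, A `<=` \bigcup_k box (a k) (b k) ->
    v <= \sum_(0 <= k <oo) (box_vol (a k) (b k))%:E)%E -> (v <= leb_vol A)%E.
Proof. by move=> vle; apply: le_ereal_inf_tmp => _ [a [b [cov ->]]]; exact: vle. Qed.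

Lemma leb_vol_ge0 A : (0 <= leb_vol A)%E.
Proof.
by apply: leb_vol_ge => a b _; apply: nneseries_ge0 => k _ _; rewrite lee_fin box_vol_ge0.
Qed.

Lemma leb_volS A B : A `<=` B -> (leb_vol A <= leb_vol B)%E.
Proof. by move=> AB; apply: leb_vol_ge => a b /(subset_trans AB); exact: leb_vol_le. Qed.

(** Serves to merge two covers into one sequence. A partial sum of [m] terms is at most the one of
    [2m] terms, which consists of [m] full pairs. *)
Lemma nneseries_interleave (f g : nat -> \bar R) :
  (forall k, 0 <= f k)%E -> (forall k, 0 <= g k)%E ->
  (\sum_(0 <= k <oo) (if odd k then g k./2 else f k./2) <=
   \sum_(0 <= k <oo) f k + \sum_(0 <= k <oo) g k)%E.
Proof.
move=> f0 g0; pose c k := (if odd k then g k./2 else f k./2).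
rewrite -[leLHS]/(\sum_(0 <= k <oo) c k)%E.
have c0 k : (0 <= c k)%E by rewrite /c; case: ifP.
apply: lime_le; first exact: is_cvg_nneseries.
apply: nearW => m.
apply: (@le_trans _ _ (\sum_(0 <= k < m.*2) c k)%E).
  by rewrite -addnn [leRHS](@big_cat_nat _ _ _ m 0%N)/= ?leq_addr// leeDl// sume_ge0.
have -> : (\sum_(0 <= k < m.*2) c k = \sum_(0 <= k < m) (f k + g k))%E.
  elim: m => [|m IH]; first by rewrite !big_geq.
  rewrite doubleS !big_nat_recr//= IH /c/= odd_double/= doubleK uphalf_double.
  by rewrite addeA.
by rewrite big_split/= leeD// nneseries_lim_ge.
Qed.

(** Covers within [e / 2] of optimal are interleaved. Infinite volumes are treated first, since
    near-optimal covers need a finite infimum. *)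
Lemma leb_volU A B : (leb_vol (A `|` B) <= leb_vol A + leb_vol B)%E.
Proof.
have [->|Aoo] := eqVneq (leb_vol A) +oo%E.
  by rewrite addye ?leey// gt_eqF// (lt_le_trans _ (leb_vol_ge0 B))// ltNy0.
have [->|Boo] := eqVneq (leb_vol B) +oo%E.
  by rewrite addey ?leey// gt_eqF// (lt_le_trans _ (leb_vol_ge0 A))// ltNy0.
have fA : leb_vol A \is a fin_num by rewrite ge0_fin_numE ?leb_vol_ge0// ltey.
have fB : leb_vol B \is a fin_num by rewrite ge0_fin_numE ?leb_vol_ge0// ltey.
apply/lee_addgt0Pr => e e0.
have e20 : 0 < e / 2 by rewrite divr_gt0.
have [_ [a [b [covA ->]]] ltA] := lb_ereal_inf_adherent e20 fA.
have [_ [a' [b' [covB ->]]] ltB] := lb_ereal_inf_adherent e20 fB.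
have cov : A `|` B `<=` \bigcup_k box (if odd k then a' k./2 else a k./2)
                                     (if odd k then b' k./2 else b k./2).
  move=> x [/covA[k _ xk]|/covB[k _ xk]].
    by exists k.*2 => //; rewrite odd_double doubleK.
  by exists k.*2.+1 => //=; rewrite odd_double/= uphalf_double.
apply: le_trans (leb_vol_le cov) _.
rewrite (eq_eseriesr (g := fun k => if odd k then (box_vol (a' k./2) (b' k./2))%:E
   else (box_vol (a k./2) (b k./2))%:E)); last by move=> k _; case: ifP.
apply: le_trans (nneseries_interleave (f := fun k => (box_vol (a k) (b k))%:E)
  (g := fun k => (box_vol (a' k) (b' k))%:E) _ _) _.
- by move=> k; rewrite lee_fin box_vol_ge0.
- by move=> k; rewrite lee_fin box_vol_ge0.
apply: le_trans (leeD (ltW ltA) (ltW ltB)) _.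
by rewrite addeACA -EFinD -splitr.
Qed.

(* Caratheodory measurability for the outer measure [leb_vol] *)
Definition splits H : Prop :=
  forall E, (leb_vol (E `&` H) + leb_vol (E `&` ~` H) <= leb_vol E)%E.

Lemma splitsC H : splits H -> splits (~` H).
Proof. by move=> sH E; rewrite setCK addeC. Qed.

Definition set_coord a (i : 'I_N) (c : R) : 'rV[R]_N :=
  \row_j if j == i then c else a 0 j.

(** Only the factor of coordinate [i] changes, and it splits additively. If the hyperplane misses
    the box, the truncation [Num.max 0] gives one piece volume 0. *)
Lemma box_vol_cut a b i (c : R) :
  box_vol a b = box_vol a (set_coord b i (Num.min (b 0 i) c)) +
                box_vol (set_coord a i (Num.max (a 0 i) c)) b.
Proof.
rewrite /box_vol !(bigD1 i (P := predT))//=.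
rewrite (eq_bigr (fun j => Num.max 0 (b 0 j - a 0 j)) (P := fun j => j != i)
  (F1 := fun j => Num.max 0 (set_coord b i _ 0 j - a 0 j))); last first.
  by move=> j /negPf ji; rewrite mxE ji.
rewrite (eq_bigr (fun j => Num.max 0 (b 0 j - a 0 j)) (P := fun j => j != i)
  (F1 := fun j => Num.max 0 (b 0 j - set_coord a i _ 0 j))); last first.
  by move=> j /negPf ji; rewrite mxE ji.
rewrite -mulrDl !mxE eqxx; congr (_ * _).
rewrite /Num.max/Num.min; do ?case: ifPn; rewrite -?leNgt.
all: move=> *; lra.
Qed.

(** Each box of a cover of [E] is cut by the hyperplane; the two families of pieces cover the two
    parts of [E] at the same total cost. *)
Lemma splits_halfspace i (c : R) : splits [set x : 'rV[R]_N | x 0 i <= c].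
Proof.
move=> E; apply: leb_vol_ge => a b cov.
pose b' k := set_coord (b k) i (Num.min (b k 0 i) c).
pose a' k := set_coord (a k) i (Num.max (a k 0 i) c).
rewrite (eq_eseriesr (g := fun k =>
  (box_vol (a k) (b' k))%:E + (box_vol (a' k) (b k))%:E)%E); last first.
  by move=> k _; rewrite -EFinD -box_vol_cut.
rewrite nneseriesD; [|by move=> k _ _; rewrite lee_fin box_vol_ge0..].
apply: leeD; apply: leb_vol_le => x [/cov[k _ xk] /= xc]; exists k => //= j.
- by rewrite mxE; case: eqP (xk j) => // -> /andP[-> ?]; rewrite le_min xc andbT.
- move/negP: xc; rewrite -ltNge => /ltW xc.
  by rewrite mxE; case: eqP (xk j) => // -> /andP[? ->]; rewrite ge_max xc !andbT.
Qed.

(** In dimension 0 the empty product would give a degenerate box volume 1, whence [0 < N]. *)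
Lemma leb_vol_sub0 A : (0 < N)%N -> A `<=` [set 0] -> leb_vol A = 0.
Proof.
move=> N0 A0; apply/eqP; rewrite eq_le leb_vol_ge0 andbT.
apply: le_trans (@leb_vol_le A (fun=> 0) (fun=> 0) _) _.
  by move=> x /A0 ->; exists 0%N => // i; rewrite mxE lexx.
rewrite eseries0// => k _ _; congr EFin.
by rewrite /box_vol (bigD1 (Ordinal N0))//= subrr maxxx mul0r.
Qed.

(** Induction on [s]: the head [H] splits off the part of [A] outside [H] and keeps [D] whole; the
    tail separates the rest, and subadditivity reassembles [A]. *)
Lemma leb_volU_splits (s : seq (set 'rV[R]_N)) A D : (0 < N)%N ->
  (forall H, List.In H s -> splits H) ->
  (forall H, List.In H s -> D `<=` H) ->
  (forall x, A x -> exists2 H, List.In H s & ~ H x) ->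
  (leb_vol A + leb_vol D <= leb_vol (A `|` D))%E.
Proof.
move=> N0; elim: s A => [|H s IH] A ss sD sA.
  have -> : A = set0 by apply/seteqP; split => // x /sA[].
  by rewrite leb_vol_sub0// add0e set0U.
apply: le_trans (ss H (or_introl erefl) (A `|` D)).
have DH := sD H (or_introl erefl).
have -> : (A `|` D) `&` H = (A `&` H) `|` D.
  by rewrite setIUl; congr (_ `|` _); apply/setIidPl.
have -> : (A `|` D) `&` ~` H = A `&` ~` H.
  rewrite setIUl; by apply/setUidPl => x [/DH Hx].
apply: (@le_trans _ _ (leb_vol (A `&` H) + leb_vol D + leb_vol (A `&` ~` H))%E).
  rewrite addeAC leeD2r//.
  by rewrite -{1}[A]setIT -(setUv H) setIUr leb_volU.
rewrite leeD2r// IH//.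
- by move=> K sK; apply: ss; right.
- by move=> K sK; apply: sD; right.
- by move=> x [/sA[K [<-|sK]]] // Kx _; exists K.
Qed.

(** Covers of the image are pulled back by the inverse homothety. This makes the volume of a small
    copy positive. *)
Lemma leb_vol_scale A x (l : R) : 0 < l ->
  ((l ^+ N)%:E * leb_vol A <= leb_vol [set (x + l *: y)%R | y in A])%E.
Proof.
move=> l0; apply: leb_vol_ge => a b cov.
rewrite -lee_pdivlMl ?exprn_gt0//.
have cov' : A `<=` \bigcup_k box (l^-1 *: (a k - x)) (l^-1 *: (b k - x)).
  move=> y Ay; have [|k _ yk] := cov (x + l *: y); first by exists y.
  exists k => // i; have := yk i; rewrite !mxE.
  by rewrite !(mulrC l^-1) ler_pdivrMr// ler_pdivlMr// lerBlDl lerBrDl (mulrC l).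
apply: le_trans (leb_vol_le cov') _.
rewrite -nneseriesZl; last by move=> k _; rewrite lee_fin box_vol_ge0.
apply: lee_nneseries => k _; first by rewrite lee_fin box_vol_ge0.
have -> : (l ^+ N)^-1 = \prod_(i < N) l^-1 by rewrite prodr_const card_ord exprVn.
rewrite -EFinM lee_fin /box_vol -big_split/=.
apply: ler_prod => i _; rewrite le_max lexx/= !mxE -mulrBr opprB addrA subrK.
have [ab|ab] := leP 0 (b k 0 i - a k 0 i); last first.
  by rewrite mulr0 ge_max lexx/= pmulr_rle0 ?invr_gt0// ltW.
by rewrite ge_max lexx andbT mulr_ge0// invr_ge0 ltW.
Qed.

Lemma leb_vol_fin A (M : R) : (0 < N)%N ->
  (forall x, A x -> `|x| <= M) -> leb_vol A \is a fin_num.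
Proof.
move=> N0 AM; rewrite ge0_fin_numE ?leb_vol_ge0//.
(* Covers are infinite sequences: one cube does the work and degenerate boxes fill the remaining
   indices. *)
pose b k : 'rV[R]_N := if k is 0 then const_mx M else 0.
have cov : A `<=` \bigcup_k box (- b k) (b k).
  move=> x /AM xM; exists 0%N => // i; rewrite /b !mxE -ler_norml.
  exact: le_trans (le_coord_norm x i) xM.
apply: le_lt_trans (leb_vol_le cov) _.
rewrite nneseries_recl//; last by move=> k; rewrite lee_fin box_vol_ge0.
rewrite eseries0 ?adde0 ?ltry//.
case=> // k _ _; congr EFin.
by rewrite /box_vol (bigD1 (Ordinal N0))//= !mxE !(oppr0, addr0) maxxx mul0r.
Qed.

End Volume.

(** * Convex hulls, and bounded finite intersections of half-spaces *)

Section Polytope.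
Context {R : realType} {N : nat}.
Implicit Types (x y d : 'rV[R]_N) (A B : set 'rV[R]_N).

Lemma subset_conv A : A `<=` conv A.
Proof.
move=> x Ax; exists 1%N, (fun=> x), (fun=> 1); split => //.
- by rewrite big_ord1.
- by rewrite big_ord1 scale1r.
Qed.

(** The two families of points are concatenated, with weights scaled by [t] and [1 - t]. *)
Lemma convex_conv A : convex_set (conv A).
Proof.
move=> _ _ t [k [p [w [Ap w0 w1 ->]]]] [l [q [v [Aq v0 v1 ->]]]] /andP[t0 t1].
pose z i := match fintype.split i with inl j => p j | inr j => q j end.
pose c i := match fintype.split i with inl j => t * w j | inr j => (1 - t) * v j end.
exists (k + l)%N, z, c; split.
- by move=> i; rewrite /z; case: fintype.split.
- by move=> i; rewrite /c; case: fintype.split => j; rewrite mulr_ge0// subr_ge0.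
- rewrite big_split_ord/= /c.
  under eq_bigr do rewrite (unsplitK (inl _)).
  under [X in _ + X]eq_bigr do rewrite (unsplitK (inr _)).
  by rewrite -!mulr_sumr w1 v1 !mulr1 addrC subrK.
- rewrite big_split_ord/= /c /z.
  under [in RHS]eq_bigr do rewrite (unsplitK (inl _)).
  under [X in _ = _ + X]eq_bigr do rewrite (unsplitK (inr _)).
  by rewrite !scaler_sumr; congr (_ + _); apply: eq_bigr => i _; rewrite scalerA.
Qed.

Lemma conv_subset A B : A `<=` B -> conv A `<=` conv B.
Proof.
by move=> AB x [k [p [w [Ap w0 w1 ->]]]]; exists k, p, w; split => // i; exact: AB.
Qed.

Lemma dotv_conv_le A y (c : R) :
  (forall x, A x -> dotv x y <= c) -> forall x, conv A x -> dotv x y <= c.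
Proof.
move=> Ac _ [k [p [w [Ap w0 w1 ->]]]]; rewrite dotv_suml.
rewrite -[c]mul1r -w1 mulr_suml; apply: ler_sum => i _.
by rewrite ler_wpM2l// Ac.
Qed.

Section HalfspaceIntersection.
Variables (k : nat) (p : 'I_k -> 'rV[R]_N) (r M : R).
Let P : set 'rV[R]_N := [set x | forall i, dotv x (p i) <= r].
Hypothesis PM : forall x, P x -> `|x| <= M.

Let active x : {set 'I_k} := [set i | dotv x (p i) == r]%SET.

(** Algebraic form of an extreme point: the normals active at [x] have trivial orthogonal
    complement. *)
Let vertex x : Prop :=
  P x /\ forall d, (forall i, i \in active x -> dotv d (p i) = 0) -> d = 0.

Lemma ray_exits x d : P x -> d != 0 -> exists i, 0 < dotv d (p i).
Proof.
move=> Px d0; apply: contrapT => /forallNP dle.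
have Pray (t : R) : 0 <= t -> P (x + t *: d).
  move=> t0 i; rewrite dotvDl dotvZl -[r]addr0 lerD ?Px//.
  by rewrite mulr_ge0_le0// leNgt; apply/negP/dle.
have nd : 0 < `|d| by rewrite normr_gt0.
(* Chosen so that [t *: d] has norm [|x| + |M| + 1], which pushes [x + t *: d] out of the ball of
   radius [M]. *)
pose t := (`|x| + `|M| + 1) / `|d|.
have t0 : 0 <= t by rewrite divr_ge0// !addr_ge0.
have := PM (Pray t t0); apply/negP; rewrite -ltNge.
have : `|t *: d| <= `|x + t *: d| + `|x|.
  by rewrite -{1}[t *: d](addKr x) addrC (le_trans (ler_normB _ _)).
rewrite normrZ (ger0_norm t0) divfK ?gt_eqF// => xtd.
by have := ler_norm M; lra.
Qed.

(** The ratio test of the simplex method: moving along [d], stop at the first constraint to become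
    tight. Those already active stay so because [d] is orthogonal to them. *)
Lemma exists_next_active x d : P x -> d != 0 ->
  (forall i, i \in active x -> dotv d (p i) = 0) ->
  exists t : R, [/\ 0 < t, P (x + t *: d) & active x \proper active (x + t *: d)].
Proof.
move=> Px d0 dact; have [i0 di0] := ray_exits Px d0.
pose F i := (r - dotv x (p i)) / dotv d (p i).
have [j dj jmin] := @arg_minP _ _ _ i0 (fun i => 0 < dotv d (p i)) F di0.
have jN : j \notin active x.
  by apply/negP => /dact dj0; move: dj; rewrite dj0 ltxx.
have xj : dotv x (p j) < r.
  by rewrite lt_neqAle Px andbT; move: jN; rewrite inE.
have t0 : 0 < F j by rewrite divr_gt0// subr_gt0.
exists (F j); split => //.
- move=> i; rewrite dotvDl dotvZl -lerBrDl.
  have [di|di] := ltP 0 (dotv d (p i)).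
    by rewrite -ler_pdivlMr//; exact: jmin.
  by rewrite (@le_trans _ _ 0)// ?subr_ge0 ?Px// mulr_ge0_le0// ltW.
- apply/properP; split.
    apply/fintype.subsetP => i iact; rewrite inE dotvDl dotvZl dact// mulr0 addr0.
    by move: iact; rewrite inE.
  exists j => //; rewrite inE dotvDl dotvZl divfK; last by rewrite gt_eqF.
  by rewrite addrC subrK.
Qed.

(** Induction on the number of inactive constraints: a point that is not a vertex lies on a segment,
    in directions [d] and [- d], between two points with strictly more active constraints. *)
Lemma subset_conv_vertex x : P x -> conv vertex x.
Proof.
have [m] := ubnP (k - #|active x|); elim: m x => // m IH x mx Px.
have [vx|nvx] := pselect (vertex x); first exact: subset_conv.
have [d [dact d0]] :
    exists d, (forall i, i \in active x -> dotv d (p i) = 0) /\ d != 0.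
  apply: contrapT => nd; apply: nvx; split => // d dact.
  by apply: contrapT => /eqP d0; apply: nd; exists d.
have IH' y : P y -> active x \proper active y -> conv vertex y.
  move=> Py /proper_card xy; apply: IH => //.
  have yk : (#|active y| <= k)%N by rewrite -[leqRHS]card_ord max_card.
  rewrite ltnS in mx; apply: leq_trans mx; exact: ltn_sub2l (leq_trans xy yk) xy.
have [t [t0 Pt xt]] := exists_next_active Px d0 dact.
have [|i iact|s [s0 Ps xs]] := @exists_next_active x (- d) Px.
- by rewrite oppr_eq0.
- by rewrite dotvNl dact// oppr0.
have ts0 : t + s != 0 by rewrite gt_eqF// addr_gt0.
(* Weights for which the displacements [t *: d] and [s *: - d] cancel. *)
pose a := s / (t + s); pose b := t / (t + s).
have ab1 : a + b = 1 by rewrite -mulrDl addrC divff.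
have abts : a * t = b * s by rewrite /a /b mulrAC [RHS]mulrAC (mulrC s).
have -> : x = a *: (x + t *: d) + (1 - a) *: (x + s *: - d).
  have -> : 1 - a = b by rewrite -ab1 addrC addKr.
  rewrite !scalerDr addrACA -[a *: x + _]scalerDl ab1 scale1r !scalerA scalerN.
  by rewrite abts subrr addr0.
apply: convex_conv; [exact: IH'|exact: IH'|].
have [s0' t0'] := (ltW s0, ltW t0).
by rewrite /a divr_ge0 ?addr_ge0//= ler_pdivrMr ?addr_gt0// mul1r lerDr.
Qed.

(** A vertex is determined by its active set, so the subsets of ['I_k] suffice to index all
    vertices. *)
Lemma is_polytope_halfspaces : P !=set0 -> is_polytope P.
Proof.
move=> [x0 Px0].
have [v0 vv0] : exists v, vertex v.
  have [[|l] [q [w [qv _ w1 _]]]] := subset_conv_vertex Px0; last by exists (q ord0).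
  by move: w1; rewrite big_ord0 => /esym/eqP; rewrite oner_eq0.
(* Subsets that are the active set of no vertex receive the default vertex [v0]. *)
have pickv (J : {set 'I_k}) : exists v, vertex v /\
    ((exists2 y, vertex y & active y = J) -> active v = J).
  have [[y vy yJ]|nJ] := pselect (exists2 y, vertex y & active y = J).
    by exists y.
  by exists v0; split.
have [f fP] := choice pickv.
pose q (i : 'I_#|{set 'I_k}|) := f (enum_val i).
exists _, q; apply/seteqP; split => [x /subset_conv_vertex|x].
  apply: conv_subset => y vy; exists (enum_rank (active y)) => //.
  rewrite /q enum_rankK; have [vf af] := fP (active y).
  (* The difference of two vertices with the same active set is orthogonal to all active normals,
     hence zero. *)
  apply/esym/eqP; rewrite -subr_eq0; apply/eqP/vy.2 => i iy.
  have : i \in active (f (active y)) by rewrite af//; exists y.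
  by move: iy; rewrite dotvBl !inE => /eqP -> /eqP ->; rewrite subrr.
move=> cx i; apply: dotv_conv_le cx => _ [j _ <-].
by have [[Pf _] _] := fP (enum_val j); exact: Pf.
Qed.

End HalfspaceIntersection.
End Polytope.

(** * Orbits under a group with the spanning property *)

Section Group.
Context {R : realType} {n : nat}.
Local Notation N := n.+1.
Variable S : set 'M[R]_N.
Hypotheses (hS : subgroup_O S) (hspan : spanning S).
Implicit Types (x y u a c : 'rV[R]_N) (Q : 'M[R]_N).

Lemma subgroup_O_tr Q : S Q -> S Q^T.
Proof.
case: hS => _ _ SV SO SQ; have /= QQ := SO Q SQ.
have [uQ _] := mulmx1_unit QQ.
by have := SV Q SQ; rewrite -[invmx Q]mulmx1 -QQ mulmxA mulVmx// mul1mx.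
Qed.

Lemma dotv_orbit Q x y : S Q -> dotv (x *m Q) (y *m Q) = dotv x y.
Proof.
by case: hS => _ _ _ SO /SO QQ; rewrite dotv_mulmx -mulmxA QQ mulmx1.
Qed.

(** Radius 2 is the bound on unit vectors in [norm_unit_sphere], so that every unit direction is
    available. *)
Lemma interior_ball (C : set 'rV[R]_N) y : interior C y ->
  exists2 t : R, 0 < t & forall v, `|v| <= 2 -> C (y + t *: v).
Proof.
move=> /nbhs_ballP[e /= e0 eC]; exists (e / 3); first by rewrite divr_gt0.
move=> v v2; apply: eC; rewrite mx_norm_ball/= opprD addrA subrr sub0r normrN.
by rewrite normrZ ger0_norm ?divr_ge0 ?(ltW e0)//; nra.
Qed.

Lemma norm_unit_sphere u : unit_sphere u -> `|u| <= 2.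
Proof.
by move=> /= u1; rewrite -[2]/(1 + 1) norm_le_of_dotvv// u1.
Qed.

Lemma unit_sphere_neq0 u : unit_sphere u -> u != 0.
Proof.
move=> /= u1; apply: contra_eq_neq u1 => ->.
by rewrite dotv0l eq_sym oner_eq0.
Qed.

(** The orbit hull of a normalized nonzero fixed vector would be a single point, which has no
    interior. *)
Lemma spanning_fixed_eq0 c : (forall Q, S Q -> c *m Q = c) -> c = 0.
Proof.
move=> cfix; apply: contrapT => /eqP c0.
have su := unit_sphere_normalize c0.
set a := _ *: c in su.
have aE x : conv [set a *m Q | Q in S] x -> x = a.
  move=> [k [p [w [pa w0 w1 ->]]]].
  have pE i : p i = a by have [Q SQ <-] := pa i; rewrite -scalemxAl cfix.
  by under eq_bigr do rewrite pE; rewrite -scaler_suml w1 scale1r.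
have [_ [y /interior_ball[t t0 yt]]] := hspan su.
have ya : y + t *: a = a by apply/aE/yt/norm_unit_sphere.
have y0 : y = a by apply: aE; rewrite -[y]addr0 -(scaler0 _ t); apply: yt; rewrite normr0.
move: ya; rewrite y0 => /eqP; rewrite -subr_eq0 addrC addKr scaler_eq0 gt_eqF//=.
exact/negP/unit_sphere_neq0.
Qed.

(** If all products are [<= 0], an interior point [y] of the orbit hull of [u] improves this to
    [<= - t]: the hull also contains [y + t *: (a *m Q)]. The strict bound keeps the origin out of
    [K]. *)
Let sphere_orbit_dotv_gt0 a u : unit_sphere a -> unit_sphere u ->
  exists2 Q, S Q & 0 < dotv (a *m Q) u.
Proof.
move=> sa su; have [S1 SM _ _] := hS; apply: contrapT => nQ.
have aQu Q : S Q -> dotv (a *m Q) u <= 0.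
  by move=> SQ; rewrite leNgt; apply/negP => auQ; apply: nQ; exists Q.
have [_ [y /interior_ball[t t0 yt]]] := hspan su.
have aQy Q : S Q -> dotv (a *m Q) y <= - t.
  move=> SQ; have aQ1 : dotv (a *m Q) (a *m Q) = 1 by rewrite dotv_orbit.
  have Cy := yt _ (norm_unit_sphere aQ1).
  suff : dotv (y + t *: (a *m Q)) (a *m Q) <= 0.
    by rewrite dotvDl dotvZl aQ1 mulr1 (dotvC y); lra.
  apply: dotv_conv_le Cy => _ [Q' SQ' <-].
  rewrite dotvC -[Q']trmxK -dotv_mulmx -mulmxA.
  by apply: aQu; apply: SM => //; exact: subgroup_O_tr.
(* the point of least norm of the invariant convex set [K] is fixed by [S] *)
pose K := \bigcap_(Q in S) [set x | dotv x (y *m Q) <= - t].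
have cK : closed K by apply: closed_bigI => Q _; exact: closed_dotv_le.
have Ka : K a.
  by move=> Q SQ /=; rewrite -dotv_trmx//; apply/aQy/subgroup_O_tr.
have [c Kc cmin] := exists_min_dotvv cK (ex_intro _ a Ka).
have c0 : c = 0.
  apply: spanning_fixed_eq0 => Q SQ.
  have KcQ : K (c *m Q).
    move=> Q' SQ' /=; rewrite dotv_mulmx -mulmxA.
    by apply: Kc; apply: SM => //; exact: subgroup_O_tr.
  (* [c] and [c *m Q] have equal norm, so if they differed their midpoint would be shorter than
     [c]. *)
  have Km : K (2^-1 *: (c + c *m Q)).
    move=> Q' SQ' /=; have := Kc _ SQ'; have := KcQ _ SQ'.
    by rewrite /= dotvZl dotvDl; lra.
  have := cmin _ Km; rewrite dotvZl dotvZr !dotvDl !dotvDr dotv_orbit//.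
  rewrite (dotvC (c *m Q)) => mid.
  apply/esym/eqP; rewrite -subr_eq0; apply/eqP/dotvv_eq0.
  apply/eqP; rewrite eq_le dotvv_ge0 andbT.
  rewrite !dotvBl !dotvBr dotv_orbit// (dotvC (c *m Q)); lra.
by have := Kc 1%:M S1; rewrite /= c0 dotv0l; lra.
Qed.

Lemma orbit_dotv_gt0 a u : a != 0 -> u != 0 ->
  exists2 Q, S Q & 0 < dotv (a *m Q) u.
Proof.
move=> a0 u0.
have [Q SQ] := sphere_orbit_dotv_gt0 (unit_sphere_normalize a0) (unit_sphere_normalize u0).
rewrite -scalemxAl dotvZl dotvZr !pmulr_rgt0 ?invr_gt0 ?sqrtr_gt0 ?dotvv_gt0//.
by exists Q.
Qed.

(** By compactness the support function of the orbit has a positive minimum on the sphere;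
    evaluating it at the normalized [x] bounds the length of [x]. *)
Lemma orbit_halfspaces_bounded a (r : R) : unit_sphere a ->
  exists M : R, forall x, (forall Q, S Q -> dotv x (a *m Q) <= r) -> `|x| <= M.
Proof.
move=> sa; have [S1 _ _ _] := hS.
pose A := [set a *m Q | Q in S].
have A0 : A !=set0 by exists (a *m 1%:M), 1%:M.
have AM x : A x -> `|x| <= 2.
  by move=> [Q SQ <-]; apply: norm_unit_sphere; rewrite /unit_sphere/= dotv_orbit.
have [u0 su0 u0min] := exists_min_support A0 AM (ex_intro _ a sa).
have d0 : 0 < support_fun A u0.
  have [Q SQ aQ] := orbit_dotv_gt0 (unit_sphere_neq0 sa) (unit_sphere_neq0 su0).
  by apply: lt_le_trans aQ _; apply: (dotv_le_support_fun A0 AM); exists Q.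
exists (`|r| / support_fun A u0) => x xr.
have [->|x0] := eqVneq x 0; first by rewrite normr0 divr_ge0// ltW.
pose s := Num.sqrt (dotv x x).
have s0 : 0 < s by rewrite sqrtr_gt0 dotvv_gt0.
have xs : `|x| <= s.
  by rewrite -ler_sqr ?nnegrE ?(ltW s0)// sqr_sqrtr ?dotvv_ge0 ?norm_sqr_le_dotv.
apply: le_trans xs _; rewrite ler_pdivlMr// mulrC -ler_pdivlMr//.
apply: le_trans (u0min _ (unit_sphere_normalize x0)) _.
apply: (support_fun_le A0 AM) => _ [Q SQ <-].
rewrite dotvZr mulrC ler_pM2r ?invr_gt0// dotvC (le_trans (xr Q SQ))//.
exact: ler_norm.
Qed.

End Group.

(** * Strict volume comparison and the maximality argument *)

(** Strictness requires additivity on [A] and the small copy [D]; the finitely many faces of a cube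
    around [x] separate them, so splitting by half-spaces is enough. *)
Lemma leb_vol_lt_convex {R : realType} {N : nat} (A P : set 'rV[R]_N) (M : R)
    (x : 'rV[R]_N) : (0 < N)%N -> closed A -> (forall y, A y -> `|y| <= M) ->
  (0 < leb_vol A)%E -> A `<=` P -> convex_set P -> P x -> ~ A x ->
  (leb_vol A < leb_vol P)%E.
Proof.
move=> N0 cA AM A0 AP cP Px nAx.
have [e e0 eA] : exists2 e : R, 0 < e & forall y, `|x - y| < e -> ~ A y.
  have /nbhs_ballP[e /= e0 eA] : nbhs x (~` A).
    by apply: open_nbhs_nbhs; split => //; exact: closed_openC.
  by exists e => // y xy; apply: eA; rewrite mx_norm_ball.
(* [c] exceeds the distance from [x] to any point of [A], so the ratio [l] puts the copy within
   [e / 2] of [x]. *)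
pose c := `|x| + `|M| + 1.
have c0 : 0 < c by rewrite ltr_wpDl ?addr_ge0.
pose l := Num.min 1 (e / (2 * c)).
have l0 : 0 < l by rewrite lt_min ltr01 divr_gt0// mulr_gt0.
have l1 : l <= 1 by rewrite ge_min lexx.
have lc : l * c <= e / 2.
  by rewrite -ler_pdivlMr// (_ : e / 2 / c = e / (2 * c)) ?ge_min ?lexx ?orbT// invfM mulrA.
pose D := [set ((1 - l) *: x + l *: y)%R | y in A].
have DP : D `<=` P.
  move=> _ [y Ay <-]; rewrite addrC; apply: cP => //; first exact: AP.
  by rewrite ltW.
have De y : D y -> `|x - y| < e / 2.
  move=> [z Az <-].
  have -> : x - ((1 - l) *: x + l *: z) = l *: (x - z).
    by rewrite scalerBl scale1r scalerBr opprD opprB addrA [x + _]addrC subrK.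
  rewrite normrZ (gtr0_norm l0); apply: lt_le_trans lc; rewrite ltr_pM2l//.
  have := ler_normB x z; have := AM z Az; have := ler_norm M.
  by rewrite /c; lra.
have D0 : (0 < leb_vol D)%E.
  apply: lt_le_trans (leb_vol_scale A _ l0).
  by rewrite mule_gt0// lte_fin exprn_gt0.
(* The half-spaces [up i] and [lo i] intersect in the cube of radius [e / 2] about [x], which
   contains [D] and misses [A]. *)
pose up i : set 'rV[R]_N := [set y | y 0 i <= x 0 i + e / 2].
pose lo i : set 'rV[R]_N := ~` [set y | y 0 i <= x 0 i - e / 2].
pose s := [seq up i | i <- enum 'I_N] ++ [seq lo i | i <- enum 'I_N].
have inS H : List.In H s <-> (exists i, H = up i) \/ (exists i, H = lo i).
  have inmap (f : 'I_N -> set 'rV[R]_N) : List.In H [seq f i | i <- enum 'I_N] <->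
      exists i, H = f i.
    split.
      by elim: (enum 'I_N) => //= i t IH [<-|/IH//]; exists i.
    move=> [i ->]; have := mem_enum 'I_N i; elim: (enum 'I_N) => //= j t IH.
    by rewrite inE => /orP[/eqP ->|/IH]; [left|right].
  split=> [Hs|[/(inmap up)|/(inmap lo)] Hs].
  - by case: (List.in_app_or _ _ _ Hs) => [/(inmap up)|/(inmap lo)]; [left|right].
  - by apply: List.in_or_app; left.
  - by apply: List.in_or_app; right.
have : (leb_vol A + leb_vol D <= leb_vol (A `|` D))%E.
  apply: (@leb_volU_splits _ _ s) => //.
  - move=> H /inS[[i ->]|[i ->]]; first exact: splits_halfspace.
    by apply: splitsC; exact: splits_halfspace.
  - move=> H /inS[[i ->]|[i ->]] y /De xy; have := le_coord_norm (x - y) i;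
      rewrite !mxE => /le_lt_trans/(_ xy); rewrite ltr_norml => /andP[? ?]; rewrite /up /lo /=; first by lra.
    by apply/negP; rewrite -ltNge; lra.
  - move=> y Ay; apply: contrapT => nH; apply: (eA y) => //.
    apply: (@le_lt_trans _ _ (e / 2)); last by lra.
    apply: norm_le_coord; first by rewrite divr_ge0// ltW.
    move=> i; rewrite !mxE ler_norml.
    have upy : up i y.
      by apply: contrapT => ?; apply: nH; exists (up i) => //; apply/inS; left; exists i.
    have loy : lo i y.
      by apply: contrapT => ?; apply: nH; exists (lo i) => //; apply/inS; right; exists i.
    move: upy loy; rewrite /up /lo /= => ? /negP; rewrite -ltNge => ?.
    by apply/andP; split; lra.
move=> AD; apply: lt_le_trans (le_trans AD _); last first.
  by apply: leb_volS => y [/AP|/DP].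
by rewrite lteDl// (leb_vol_fin N0 AM).
Qed.

Theorem theorem4p2 (R : realType) (n : nat) (hn : (1 <= n)%N)
  (S : set 'M[R]_(n.+1))
  (hS : subgroup_O S) (hdisc : discrete_set S) (hspan : spanning S)
  (Om : set 'rV[R]_(n.+1))
  (hOm : K0 S Om) (hvol : (0 < leb_vol Om)%E)
  (hmax : forall Om' : set 'rV[R]_(n.+1), K0 S Om' -> (0 < leb_vol Om')%E ->
            (F_minf Om' <= F_minf Om)%E) :
  is_polytope Om /\ S_invariant S Om.
Proof.
have [[cOm cvOm neOm] Om0 invOm] := hOm; split => //.
have [S1 SM _ _] := hS.
have clOm : closed Om by apply: compact_closed cOm; exact: norm_hausdorff.
have [M OmM] : exists M : R, forall x, Om x -> `|x| <= M.
  have [M [_ bM]] := compact_bounded cOm; exists (M + 1) => x Omx.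
  by apply: bM Omx; rewrite ltrDl.
have [a Oma a0] : exists2 a, Om a & a != 0.
  apply: contrapT => na; move: hvol; rewrite leb_vol_sub0 ?ltxx// => x Omx.
  by apply: contrapT => /eqP x0; apply: na; exists x.
have s0 : @unit_sphere R n.+1 !=set0 by eexists; exact: unit_sphere_normalize a0.
have [u su umin] := exists_min_support neOm OmM s0.
set r := support_fun Om u in umin.
(* The orbit of [a] stays in [Om], and one of its points has positive product with [u]. *)
have r0 : 0 < r.
  have [Q SQ aQ] := orbit_dotv_gt0 hS hspan a0 (unit_sphere_neq0 su).
  apply: lt_le_trans aQ (dotv_le_support_fun neOm OmM _ _).
  by rewrite -(invOm Q SQ); exists a.
pose P : set 'rV[R]_n.+1 := [set x | forall Q, S Q -> dotv x (u *m Q) <= r].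
have OmP : Om `<=` P.
  move=> x Omx Q SQ; rewrite -dotv_trmx//.
  apply: (dotv_le_support_fun neOm OmM).
  by rewrite -(invOm _ (subgroup_O_tr hS SQ)); exists x.
have [M' PM] := orbit_halfspaces_bounded hS hspan r su.
have cvP : convex_set P.
  move=> x y t Px Py /andP[t0 t1] Q SQ; rewrite dotvDl !dotvZl.
  have := Px Q SQ; have := Py Q SQ; nra.
have clP : closed P.
  have -> : P = \bigcap_(Q in S) [set x | dotv x (u *m Q) <= r].
    by apply/seteqP; split => x.
  by apply: closed_bigI => Q _; exact: closed_dotv_le.
have SP Q x : S Q -> P x -> P (x *m Q).
  move=> SQ Px Q' SQ'; rewrite dotv_mulmx -mulmxA.
  by apply: Px; apply: SM => //; exact: subgroup_O_tr.
have neP : P !=set0 by exists 0; exact: OmP.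
have K0P : K0 S P.
  split; [split => //|exact: OmP|].
    by apply: bounded_closed_compact => //; exact: bounded_setP PM.
  move=> Q SQ; apply/seteqP; split => [_ [x Px <-]|x Px]; first exact: SP.
  exists (x *m Q^T); first by apply: SP => //; exact: subgroup_O_tr.
  have [_ _ _ SO] := hS; have := SO _ (subgroup_O_tr hS SQ).
  by rewrite /Defs.orthogonal trmxK -mulmxA => ->; rewrite mulmx1.
have minOm : min_support Om = r by apply: (min_supportE su).
(* The lower bound comes from the inclusion of [Om] in [P]; the upper one from the half-space of [P]
   with [Q = 1], whose normal is [u]. *)
have minP : min_support P = r.
  have rP v : unit_sphere v -> r <= support_fun P v.
    move=> sv; apply: le_trans (umin v sv) _; apply: (support_fun_le neOm OmM) => x Omx.
    exact: (dotv_le_support_fun neP PM) (OmP _ Omx).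
  apply: (min_supportE su) => //; apply/eqP; rewrite eq_le rP// andbT.
  apply: (support_fun_le neP PM) => x /(_ 1%:M S1); by rewrite mulmx1.
(* Equal positive minimal supports give both functionals the same finite factor, which cancels. *)
have leP : (leb_vol P <= leb_vol Om)%E.
  have := hmax P K0P (lt_le_trans hvol (leb_volS OmP)).
  by rewrite /F_minf minOm minP r0 lee_pmul2l// lte_fin divr_gt0// exprn_gt0.
have -> : Om = P.
  apply/seteqP; split => // x Px; apply: contrapT => nOmx.
  have := leb_vol_lt_convex (ltn0Sn n) clOm OmM hvol OmP cvP Px nOmx.
  by rewrite ltNge leP.
have [[k [p pE]] _] := hspan u su.
(* A linear bound on generators passes to their hull; the orbit of [u] and the finite family [p]
   have the same hull, so they impose the same constraints. *)
have PE : P = [set x | forall i, dotv x (p i) <= r].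
  apply/seteqP; split => x Px.
    move=> i; have /subset_conv : range p (p i) by exists i.
    rewrite -pE dotvC => /dotv_conv_le; apply => _ [Q SQ <-].
    by rewrite dotvC; exact: Px.
  move=> Q SQ; have /subset_conv : [set u *m Q | Q in S] (u *m Q) by exists Q.
  rewrite pE dotvC => /dotv_conv_le; apply => _ [i _ <-].
  by rewrite dotvC; exact: Px.
rewrite PE; apply: (@is_polytope_halfspaces _ _ _ p r M') => [x|]; last by rewrite -PE.
move=> Px; suff : P x by exact: PM.
by rewrite PE.
Qed.
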